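(* Under the standing assumptions on the data described in the context, if $(\mathsf{RP}_1)$ is feasible, then it has an optimal solution, and one can be found by solving the convex conic program $(\mathsf{RP}_2)$, in the following sense. Let $(v^*,d^*,u^* )$ be an optimal solution to $(\mathsf{RP}_2)$. For each $j\in\mathcal{J}$ let $$x_j^*=\begin{cases}\underline{x}_j & \text{if } d_j^*=0,\\ u_j^*/d_j^* & \text{if } d_j^*>0,\end{cases}\qquad a_j^*=\begin{cases}0 & \text{if } d_j^*=0,\\ \dfrac{d_j^*}{\exp(\alpha_j-\beta_j x_j^* )\,v_j^*} & \text{if } d_j^*>0.\end{cases}$$ Then $(v^*,x^*,a^* )$ is an optimal solution to $(\mathsf{RP}_1)$.
   Context: Standing assumptions and data: $\mathcal{J}$ is a finite set of $J$ products. For each $j\in\mathcal{J}$ there are real numbers $\underline{x}_j\le\overline{x}_j$ (price bounds), $\psi_j$ (unit cost), $\alpha_j$, and $\beta_j>0$, such that $Q_j(x_j):=\exp(\alpha_j-\beta_jx_j)\in[0,1]$ for all $x_j\in[\underline{x}_j,\overline{x}_j]$. There are a vector $\theta=(\theta_j)_{j\in\mathcal{J}}\ge0$ with $\sum_{j\in\mathcal{J}}\theta_j=1$ and a matrix $\rho=(\rho_{ij})_{i,j\in\mathcal{J}}\ge0$ such that $I-\rho$ is nonsingular and $\sum_{n\ge1}\rho^n<\infty$ entrywise. $\mathcal{R}$ is a finite set of resources, with real $\varphi_r$ (capacity) and $\phi_{rj}$ (usage of $r$ per unit of $j$). $\overline{\lambda}\ge0$ is the total arrival volume (the integral of the arrival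 rate over the horizon). Problem $(\mathsf{RP}_1)$: over $v,x,a\in\mathbb{R}^{\mathcal{J}}$, maximize $\overline{\lambda}\sum_{j\in\mathcal{J}}(x_j-\psi_j)a_j\exp(\alpha_j-\beta_jx_j)v_j$ subject to: $v_j=\theta_j+\sum_{i\in\mathcal{J}}[1-a_i\exp(\alpha_i-\beta_ix_i)]\rho_{ij}v_i$ for all $j$; $\overline{\lambda}\sum_{j\in\mathcal{J}}\phi_{rj}a_j\exp(\alpha_j-\beta_jx_j)v_j\le\varphi_r$ for all $r\in\mathcal{R}$; $a_j\in[0,1]$ and $\underline{x}_j\le x_j\le\overline{x}_j$ for all $j$. Exponential cone: $\mathcal{K}_{\exp}=\{(a_1,a_2,a_3): a_3\le a_2\ln(a_1/a_2),\,a_1>0,\,a_2>0\}\cup\{(a_1,0,a_3): a_1\ge0,\,a_3\le0\}$. Problem $(\mathsf{RP}_2)$: over $v,d,u\in\mathbb{R}^{\mathcal{J}}$, maximize $\overline{\lambda}\sum_{j\in\mathcal{J}}(u_j-\psi_jd_j)$ subject to: $v_j=\theta_j+\sum_{i\in\mathcal{J}}\rho_{ij}(v_i-d_i)$ for all $j$; $\overline{\lambda}\sum_{j\in\mathcal{J}}\phi_{rj}d_j\le\varphi_r$ for all $r\in\mathcal{R}$; $(v_j,d_j,\beta_ju_j-\alpha_jd_j)\in\mathcal{K}_{\exp}$ and $\underline{x}_jd_j\le u_j\le\overline{x}_jd_j$ for all $j$. *)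

(* Defs.v *)
From HB Require Import structures.
From mathcomp Require Import all_boot all_order all_algebra.
From mathcomp Require Import all_classical all_reals all_analysis.

Set Implicit Arguments.
Unset Strict Implicit.
Unset Printing Implicit Defensive.

Import Order.TTheory GRing.Theory Num.Theory.
Import numFieldNormedType.Exports.

Local Open Scope classical_set_scope.
Local Open Scope ring_scope.

(* J products and m resources, indexed by 'I_J and 'I_m. *)
Record pricing_data (R : realType) (J m : nat) := PricingData {
  x_lo : 'I_J -> R;             (* price bounds *)
  x_up : 'I_J -> R;
  psi : 'I_J -> R;              (* unit costs *)
  alpha : 'I_J -> R;
  beta : 'I_J -> R;
  theta : 'I_J -> R;
  rho : 'M[R]_J;                (* rho i j weighs the flow from product i to j *)
  varphi : 'I_m -> R;           (* resource capacities *)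
  phi : 'M[R]_(m, J);           (* phi r j: usage of r per unit of j *)
  lambda_bar : R                (* total arrival volume *)
}.

Definition purchase_prob (R : realType) (J m : nat) (D : pricing_data R J m)
    (j : 'I_J) (x : R) : R :=
  expR (alpha D j - beta D j * x).

Record standing_assumptions (R : realType) (J m : nat)
    (D : pricing_data R J m) : Prop := StandingAssumptions {
  price_bounds_le : forall j, x_lo D j <= x_up D j;
  beta_gt0 : forall j, 0 < beta D j;
  purchase_prob_01 : forall j x, x_lo D j <= x <= x_up D j ->
    0 <= purchase_prob D j x <= 1;
  theta_ge0 : forall j, 0 <= theta D j;
  theta_sum1 : \sum_(j < J) theta D j = 1;
  rho_ge0 : forall i j, 0 <= rho D i j;
  rho_nonsingular : 1%:M - rho D \in unitmx;
  rho_summable : forall i j, cvgn (series (fun k => (rho D ^+ k.+1) i j));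
  lambda_bar_ge0 : 0 <= lambda_bar D
}.

Definition Kexp (R : realType) : set (R * R * R) :=
  [set p : R * R * R | let: (a1, a2, a3) := p in
     [/\ a3 <= a2 * ln (a1 / a2), 0 < a1 & 0 < a2] \/
     [/\ a2 = 0, 0 <= a1 & a3 <= 0]].

Definition is_optimal (R : realType) (T : Type) (feasible : set T)
    (objective : T -> R) (z : T) : Prop :=
  feasible z /\ forall y, feasible y -> objective y <= objective z.

Section programs.
Context (R : realType) (J m : nat) (D : pricing_data R J m).

Definition RP1_feasible : set ('rV[R]_J * 'rV[R]_J * 'rV[R]_J) :=
  [set z : 'rV[R]_J * 'rV[R]_J * 'rV[R]_J | let: (v, x, a) := z in
    [/\ forall j, v 0 j = theta D j +
          \sum_(i < J) (1 - a 0 i * expR (alpha D i - beta D i * x 0 i))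
                       * rho D i j * v 0 i,
        forall r, lambda_bar D *
          (\sum_(j < J) phi D r j * a 0 j
             * expR (alpha D j - beta D j * x 0 j) * v 0 j) <= varphi D r,
        forall j, 0 <= a 0 j <= 1
      & forall j, x_lo D j <= x 0 j <= x_up D j]].

Definition RP1_objective (z : 'rV[R]_J * 'rV[R]_J * 'rV[R]_J) : R :=
  let: (v, x, a) := z in
  lambda_bar D * (\sum_(j < J) (x 0 j - psi D j) * a 0 j
                    * expR (alpha D j - beta D j * x 0 j) * v 0 j).

Definition RP1_optimal := is_optimal RP1_feasible RP1_objective.

Definition RP2_feasible : set ('rV[R]_J * 'rV[R]_J * 'rV[R]_J) :=
  [set z : 'rV[R]_J * 'rV[R]_J * 'rV[R]_J | let: (v, d, u) := z in
    [/\ forall j, v 0 j = theta D j +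
          \sum_(i < J) rho D i j * (v 0 i - d 0 i),
        forall r, lambda_bar D * (\sum_(j < J) phi D r j * d 0 j) <= varphi D r,
        forall j, Kexp (v 0 j, d 0 j, beta D j * u 0 j - alpha D j * d 0 j)
      & forall j, x_lo D j * d 0 j <= u 0 j <= x_up D j * d 0 j]].

Definition RP2_objective (z : 'rV[R]_J * 'rV[R]_J * 'rV[R]_J) : R :=
  let: (v, d, u) := z in
  lambda_bar D * (\sum_(j < J) (u 0 j - psi D j * d 0 j)).

Definition RP2_optimal := is_optimal RP2_feasible RP2_objective.

(* Every RP2-feasible d is nonnegative, so the else-branches below are the
   case d_j > 0. *)
Definition recovered_x (d u : 'rV[R]_J) : 'rV[R]_J :=
  \row_j (if d 0 j == 0 then x_lo D j else u 0 j / d 0 j).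

Definition recovered_a (v d u : 'rV[R]_J) : 'rV[R]_J :=
  \row_j (if d 0 j == 0 then 0
          else d 0 j / (expR (alpha D j - beta D j * recovered_x d u 0 j)
                        * v 0 j)).

End programs.

(* Main.v *)
Require Import Defs.
From HB Require Import structures.
From mathcomp Require Import all_boot all_order all_algebra.
From mathcomp Require Import all_classical all_reals all_analysis.
From mathcomp Require Import ring lra.

Set Implicit Arguments.
Unset Strict Implicit.
Unset Printing Implicit Defensive.

Import Order.TTheory GRing.Theory Num.Theory.
Import numFieldNormedType.Exports.

Local Open Scope classical_set_scope.
Local Open Scope ring_scope.

(* Substituting the sales rates [d_j = a_j Q_j(x_j) v_j] and revenue rates
   [u_j = x_j d_j] turns (RP1) into (RP2): for [d_j > 0], membership in the
   exponential cone says [d_j <= Q_j(u_j / d_j) v_j], i.e. [a_j <= 1].  This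
   requires [v >= 0] in (RP1), which holds because a solution of [z <= z^+ rho]
   satisfies [z^+ <= z^+ rho^k -> 0]; the same principle applied to
   [v - theta (I - rho)^-1] bounds [v] above.  Hence the feasible set of (RP1)
   is compact and its optimum is attained. *)

(** * The exponential cone and convexity of (RP2) *)

(* [a2 * ln (a1 / a2)] is the infimum over [s] of the linear functions
   [a1 * expR (- s) + (s - 1) * a2] of [(a1, a2)]. *)
Lemma Kexp_halfspaces (R : realType) (a1 a2 a3 : R) :
  Kexp (a1, a2, a3) <->
  [/\ 0 <= a1, 0 <= a2 & forall s, a3 <= a1 * expR (- s) + (s - 1) * a2].
Proof.
split=> [[[h a10 a20]|[-> a10 h]]|[a10 a20 h]].
- split; [exact: ltW | exact: ltW | move=> s; apply: (le_trans h)].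
  have q0 : 0 < a1 / a2 by rewrite divr_gt0.
  (* The tangent bound [1 + t <= expR t] at [t = ln (a1 / a2) - s], multiplied by [a2], is the
     half-space inequality for [s]. *)
  have := expR_ge1Dx (ln (a1 / a2) - s).
  rewrite expRD lnK ?posrE// -(ler_pM2l a20).
  have -> : a2 * (a1 / a2 * expR (- s)) = a1 * expR (- s).
    by rewrite mulrA mulrCA divff ?mulr1// gt_eqF.
  lra.
- split=> // s; rewrite mulr0 addr0 (le_trans h)// mulr_ge0// expR_ge0.
- move: a20; rewrite le_eqVlt => /predU1P[a20|a20].
    rewrite -{a2}a20 in h *; right; split=> //.
    rewrite leNgt; apply/negP => a30.
    move: a10; rewrite le_eqVlt => /predU1P[a10|a10].
      by have := h 0; rewrite -a10 mul0r mulr0 addr0 leNgt a30.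
    (* With [a2 = 0] the bound is [a3 <= a1 * expR (- s)]; this [s] makes the right side [a3 / 2],
       impossible for [a3 > 0]. *)
    have := h (ln (2 * a1 / a3)).
    rewrite mulr0 addr0 expRN lnK ?posrE ?divr_gt0 ?mulr_gt0//.
    have -> : a1 * (2 * a1 / a3)^-1 = a3 / 2.
      by field; rewrite !gt_eqF.
    lra.
  left; move: a10; rewrite le_eqVlt => /predU1P[a10|a10].
    (* With [a1 = 0] this [s] yields [a3 <= a3 - a2], contradicting [a2 > 0]. *)
    have := h (a3 / a2); rewrite -a10 mul0r add0r mulrBl divfK ?gt_eqF//.
    lra.
  (* This [s] minimizes the right side, with value [a2 * ln (a1 / a2)]. *)
  split=> //; have := h (ln (a1 / a2)).
  rewrite expRN lnK ?posrE ?divr_gt0//.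
  have -> : a1 * (a1 / a2)^-1 = a2 by field; rewrite !gt_eqF.
  lra.
Qed.

(** The half-space inequalities are linear and homogeneous, so nonnegative combinations preserve
    them; the face [a2 = 0] needs no separate case. *)
Lemma Kexp_cone (R : realType) (a1 a2 a3 b1 b2 b3 s t : R) :
  0 <= s -> 0 <= t -> Kexp (a1, a2, a3) -> Kexp (b1, b2, b3) ->
  Kexp (s * a1 + t * b1, s * a2 + t * b2, s * a3 + t * b3).
Proof.
move=> s0 t0 /Kexp_halfspaces[a10 a20 ha] /Kexp_halfspaces[b10 b20 hb].
apply/Kexp_halfspaces; split; rewrite ?addr_ge0 ?mulr_ge0// => r.
have := ler_wpM2l s0 (ha r); have := ler_wpM2l t0 (hb r).
lra.
Qed.

(** The flow, resource and price constraints are affine in [(v, d, u)], and the remaining one is the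
    preimage of a convex cone under a linear map. *)
Lemma RP2_convex (R : realType) (J m : nat) (D : pricing_data R J m) :
  convex_set (RP2_feasible D).
Proof.
move=> [[v d] u] [[v' d'] u'] k /set_mem[fl re co bo] /set_mem[fl' re' co' bo'].
apply/mem_set; pose s := k%:num; pose t := 1 - s.
have s0 : 0 <= s by exact: (ge0 k).
have t0 : 0 <= t by rewrite subr_ge0; exact: (le1 k).
have st : s + t = 1 by rewrite addrC subrK.
change (RP2_feasible D
  (s *: v + t *: v', s *: d + t *: d', s *: u + t *: u')).
split.
- move=> j; rewrite !mxE fl fl'.
  under [in RHS]eq_bigr => i _.
    rewrite !mxE.
    have -> : rho D i j * (s * v 0 i + t * v' 0 i - (s * d 0 i + t * d' 0 i))
       = s * (rho D i j * (v 0 i - d 0 i)) +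
         t * (rho D i j * (v' 0 i - d' 0 i)) by ring.
    over.
  by rewrite big_split/= -!mulr_sumr -[in RHS](mul1r (theta D j)) -st; ring.
- move=> r; have := ler_wpM2l s0 (re r); have := ler_wpM2l t0 (re' r).
  rewrite -[varphi D r in X in _ -> _ -> X]mul1r -st.
  under [in X in _ -> _ -> X]eq_bigr => j _.
    rewrite !mxE.
    have -> : phi D r j * (s * d 0 j + t * d' 0 j)
       = s * (phi D r j * d 0 j) + t * (phi D r j * d' 0 j) by ring.
    over.
  rewrite big_split/= -!mulr_sumr; lra.
- move=> j; have := Kexp_cone s0 t0 (co j) (co' j).
  congr Kexp; rewrite !mxE; congr pair; ring.
- move=> j; rewrite !mxE.
  move: (bo j) (bo' j) => /andP[b1 b2] /andP[b1' b2'].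
  have := ler_wpM2l s0 b1; have := ler_wpM2l t0 b1'.
  have := ler_wpM2l s0 b2; have := ler_wpM2l t0 b2'.
  by move=> *; apply/andP; split; lra.
Qed.

(** * A comparison principle for nonnegative matrices with summable powers *)

Lemma cvg_sumr (R : realType) (T I : Type) (F : set_system T) {FF : Filter F}
    (r : seq I) (f : I -> T -> R) (l : I -> R) :
  (forall i, f i x @[x --> F] --> l i) ->
  \sum_(i <- r) f i x @[x --> F] --> \sum_(i <- r) l i.
Proof.
move=> fl; apply: cvg_big => // -[x y].
by apply: cvgD; [exact: cvg_fst | exact: cvg_snd].
Qed.

(** Since [A >= 0], the positive part inherits the inequality, which can then be iterated through
    all powers of [A]; these tend to 0, being the terms of convergent series. *)
Lemma subharmonic_le0 (R : realType) (n : nat) (A : 'M[R]_n) (z : 'I_n -> R) :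
  (forall i j, 0 <= A i j) ->
  (forall i j, cvgn (series (fun k => (A ^+ k.+1) i j))) ->
  (forall j, z j <= \sum_(i < n) Num.max 0 (z i) * A i j) ->
  forall j, z j <= 0.
Proof.
move=> A0 cA hz.
have hp j : Num.max 0 (z j) <= \sum_(i < n) Num.max 0 (z i) * A i j.
  rewrite ge_max hz andbT sumr_ge0// => i _.
  by rewrite mulr_ge0// le_max lexx.
have hpk k j : Num.max 0 (z j) <=
    \sum_(i < n) Num.max 0 (z i) * (A ^+ k.+1) i j.
  elim: k j => [|k IH] j; first by rewrite expr1.
  apply: (le_trans (hp j)); rewrite exprSr.
  under [in leRHS]eq_bigr do rewrite mxE mulr_sumr.
  rewrite exchange_big/=; apply: ler_sum => i _.
  under eq_bigr do rewrite mulrA.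
  by rewrite -mulr_suml ler_wpM2r.
move=> j.
have lim0 :
    (fun k => \sum_(i < n) Num.max 0 (z i) * (A ^+ k.+1) i j) @ \oo --> 0.
  rewrite -[X in _ --> X](_ : \sum_(i < n) Num.max 0 (z i) * 0 = 0); last first.
    by rewrite -mulr_suml mulr0.
  apply: cvg_sumr => i; apply: cvgM; first exact: cvg_cst.
  exact: cvg_series_cvg_0.
rewrite -(cvg_lim _ lim0)//; apply: limr_ge; first exact: cvgP lim0.
by near=> k; rewrite (le_trans _ (hpk k j))// le_max lexx orbT.
Unshelve. all: by end_near.
Qed.

Section programs.
Context (R : realType) (J m : nat) (D : pricing_data R J m).
Context (hD : standing_assumptions D).

(** * Bounds on [v] in (RP1) *)

(** The flow coefficients are thus [rho] scaled by factors in [0, 1], which permits comparison with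
    [rho] itself. *)
Lemma RP1_retention_01 (v x a : 'rV[R]_J) i : RP1_feasible D (v, x, a) ->
  0 <= 1 - a 0 i * expR (alpha D i - beta D i * x 0 i) <= 1.
Proof.
move=> [_ _ /(_ i)/andP[a0 a1] /(_ i) hx].
have /andP[q0 q1] := purchase_prob_01 hD hx.
by rewrite subr_ge0 gerBl mulr_ge0// andbT mulr_ile1.
Qed.

Lemma RP1_v_ge0 (v x a : 'rV[R]_J) j : RP1_feasible D (v, x, a) -> 0 <= v 0 j.
Proof.
move=> f; have [fl _ _ _] := f; rewrite -oppr_le0.
apply: (subharmonic_le0 (rho_ge0 hD) (rho_summable hD)
  (z := fun i => - v 0 i)) => {}j.
rewrite {1}fl opprD -sumrN -[leRHS]add0r lerD ?oppr_le0 ?(theta_ge0 hD)//.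
apply: ler_sum => i _.
have /andP[g0 g1] := RP1_retention_01 i f; have r0 := rho_ge0 hD i j.
rewrite mulrAC -mulNr ler_wpM2r// -mulrN le_max.
(* With [g] the retention factor, [- g * v_i] is at most 0 if [v_i >= 0], and at most [- v_i] if
   [v_i < 0]. *)
have [vi|vi] := leP 0 (v 0 i); apply/orP; [left|right].
  by rewrite mulr_ge0_le0// oppr_le0.
by rewrite ler_piMl// oppr_ge0 ltW.
Qed.

(** The bound is the flow when nothing is sold ([a = 0]). It depends on [D] alone, so it holds
    uniformly over the feasible set. *)
Lemma RP1_v_bounded : exists w : 'I_J -> R,
  forall (v x a : 'rV[R]_J) j, RP1_feasible D (v, x, a) -> v 0 j <= w j.
Proof.
pose w := \row_j theta D j *m invmx (1%:M - rho D).
have wE j : w 0 j = theta D j + \sum_(i < J) w 0 i * rho D i j.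
  have := mulmxKV (rho_nonsingular hD) (\row_j theta D j).
  rewrite -/w mulmxBr mulmx1 => /rowP/(_ j); rewrite !mxE => <-.
  by rewrite subrK.
exists (w 0) => v x a j f; have [fl _ _ _] := f; rewrite -subr_le0.
apply: (subharmonic_le0 (rho_ge0 hD) (rho_summable hD)
  (z := fun i => v 0 i - w 0 i)) => {}j.
rewrite {1}fl {1}wE opprD addrACA subrr add0r -sumrB; apply: ler_sum => i _.
have /andP[g0 g1] := RP1_retention_01 i f.
have v0 := RP1_v_ge0 i f; have r0 := rho_ge0 hD i j.
have -> : forall g, g * rho D i j * v 0 i - w 0 i * rho D i j =
  (g * v 0 i - w 0 i) * rho D i j by move=> g; ring.
rewrite ler_wpM2r// le_max; apply/orP; right.
by rewrite lerD2r ler_piMl.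
Qed.

(** * Objective-preserving maps between the two programs *)

Lemma RP1_to_RP2 (v x a : 'rV[R]_J) :
  let d := \row_j (a 0 j * expR (alpha D j - beta D j * x 0 j) * v 0 j) in
  let u := \row_j (x 0 j * d 0 j) in
  RP1_feasible D (v, x, a) ->
  RP2_feasible D (v, d, u) /\
  RP2_objective D (v, d, u) = RP1_objective D (v, x, a).
Proof.
move=> d u f; have [fl re ha hx] := f.
have d0 j : 0 <= d 0 j.
  by have /andP[a0 _] := ha j; rewrite mxE !mulr_ge0 ?expR_ge0 ?(RP1_v_ge0 _ f).
split; last first.
  by congr (_ * _); apply: eq_bigr => j _; rewrite !mxE; ring.
split.
- move=> j; rewrite {1}fl; congr (_ + _); apply: eq_bigr => i _.
  by rewrite !mxE; ring.
- move=> r; apply: le_trans (re r); rewrite le_eqVlt; apply/predU1P; left.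
  by congr (_ * _); apply: eq_bigr => j _; rewrite !mxE; ring.
- move=> j; have /andP[a0 a1] := ha j; have v0 := RP1_v_ge0 j f.
  have [dj0|dj0] := eqVneq (d 0 j) 0.
    (* A product without sales lies on the face [a2 = 0] of the cone. *)
    by right; split=> //; rewrite [u 0 j]mxE dj0 !mulr0 subr0.
  have {dj0} djp : 0 < d 0 j by rewrite lt_neqAle eq_sym dj0 d0.
  have vp : 0 < v 0 j.
    rewrite lt_neqAle v0 andbT; apply/eqP => vj0.
    by move: djp; rewrite mxE -vj0 mulr0 ltxx.
  left; split=> //; rewrite [u 0 j]mxE.
  (* Dividing by [d_j] and exponentiating, the cone inequality becomes [d_j <= Q_j(x_j) v_j], which
     is [a_j <= 1]. *)
  rewrite mulrA -mulrBl mulrC ler_pM2l// -ler_expR lnK ?posrE ?divr_gt0//.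
  rewrite ler_pdivlMr// [d 0 j]mxE -[_ - alpha D j]opprB expRN.
  rewrite -mulrA mulrCA mulKf ?gt_eqF ?expR_gt0//.
  by rewrite ler_piMl.
- move=> j; have /andP[x0 x1] := hx j; rewrite [u 0 j]mxE.
  by rewrite !ler_wpM2r.
Qed.

Lemma RP2_to_RP1 (v d u : 'rV[R]_J) :
  let x := recovered_x D d u in let a := recovered_a D v d u in
  RP2_feasible D (v, d, u) ->
  RP1_feasible D (v, x, a) /\
  RP1_objective D (v, x, a) = RP2_objective D (v, d, u).
Proof.
move=> x a [fl re co bo].
have v0 j : 0 <= v 0 j by have /Kexp_halfspaces[] := co j.
have d0 j : 0 <= d 0 j by have /Kexp_halfspaces[] := co j.
have q0 j : 0 < expR (alpha D j - beta D j * x 0 j) by exact: expR_gt0.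
(* The cone constraint in multiplicative form; it gives [a_j <= 1], and [v_j != 0] whenever
   [d_j > 0]. *)
have dqv j : d 0 j <= expR (alpha D j - beta D j * x 0 j) * v 0 j.
  have [dj0|dj0] := eqVneq (d 0 j) 0; first by rewrite dj0 mulr_ge0// ltW.
  have [[h vp dp]|[/eqP]] := co j; last by rewrite (negbTE dj0).
  rewrite -ler_pdivrMl// -expRN opprB -ler_pdivlMr//.
  rewrite -[leRHS]lnK ?posrE ?divr_gt0// ler_expR -(ler_pM2l dp).
  rewrite (le_trans _ h)// [x 0 j]mxE (negbTE dj0) le_eqVlt.
  by apply/predU1P; left; field.
have aqv j : a 0 j * expR (alpha D j - beta D j * x 0 j) * v 0 j = d 0 j.
  rewrite [a 0 j]mxE; case: eqVneq => [->|dj0]; first by rewrite !mul0r.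
  rewrite -mulrA divfK// gt_eqF// (lt_le_trans _ (dqv j))//.
  by rewrite lt_neqAle eq_sym dj0 d0.
(* If [d_j = 0], the scaled price bounds force [u_j = 0], so the default price does not affect
   revenue. *)
have xd j : x 0 j * d 0 j = u 0 j.
  rewrite mxE; case: eqVneq => [dj0|dj0]; last by rewrite divfK.
  by have := bo j; rewrite dj0 !mulr0 => /andP[? ?]; apply/le_anti/andP.
split; last first.
  congr (_ * _); apply: eq_bigr => j _.
  by rewrite -!mulrA [a 0 j * _]mulrA aqv mulrBl xd.
split.
- move=> j; rewrite {1}fl; congr (_ + _); apply: eq_bigr => i _.
  rewrite -[d 0 i]aqv; ring.
- move=> r; apply: le_trans (re r); rewrite le_eqVlt; apply/predU1P; left.
  by congr (_ * _); apply: eq_bigr => j _; rewrite -(aqv j); ring.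
- move=> j; rewrite [a 0 j]mxE; case: eqVneq => [_|dj0].
    by rewrite lexx ler01.
  have p0 := lt_le_trans (_ : 0 < d 0 j) (dqv j).
  have {}p0 := p0 ltac:(by rewrite lt_neqAle eq_sym dj0 d0).
  by rewrite divr_ge0 ?d0 ?(ltW p0)// ler_pdivrMr// mul1r dqv.
- move=> j; have [dj0|dj0] := eqVneq (d 0 j) 0; rewrite [x 0 j]mxE.
    by rewrite dj0 eqxx lexx (price_bounds_le hD).
  have dp : 0 < d 0 j by rewrite lt_neqAle eq_sym dj0 d0.
  by rewrite (negbTE dj0) ler_pdivlMr// ler_pdivrMr.
Qed.

(** * Continuity and compactness for (RP1) *)

Let program_point := ('rV[R]_J * 'rV[R]_J * 'rV[R]_J)%type.

Let continuous_v j : continuous (fun z : program_point => z.1.1 0 j).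
Proof.
move=> z; apply: (cvg_comp _ (fun M : 'rV[R]_J => M 0 j));
  last exact: coord_continuous.
by apply: (cvg_comp fst fst); exact: cvg_fst.
Qed.

Let continuous_x j : continuous (fun z : program_point => z.1.2 0 j).
Proof.
move=> z; apply: (cvg_comp _ (fun M : 'rV[R]_J => M 0 j));
  last exact: coord_continuous.
by apply: (cvg_comp fst snd); [exact: cvg_fst | exact: cvg_snd].
Qed.

Let continuous_a j : continuous (fun z : program_point => z.2 0 j).
Proof.
move=> z; apply: (cvg_comp _ (fun M : 'rV[R]_J => M 0 j));
  last exact: coord_continuous.
exact: cvg_snd.
Qed.

Let continuous_q j :
  continuous (fun z : program_point => expR (alpha D j - beta D j * z.1.2 0 j)).
Proof.
move=> z; apply: (cvg_comp _ expR); last exact: continuous_expR.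
apply: cvgB; first exact: cvg_cst.
by apply: cvgM; [exact: cvg_cst | exact: continuous_x].
Qed.

Lemma RP1_objective_continuous : continuous (RP1_objective D).
Proof.
have -> : RP1_objective D = fun z : program_point => lambda_bar D *
    \sum_(j < J) (z.1.2 0 j - psi D j) * z.2 0 j
       * expR (alpha D j - beta D j * z.1.2 0 j) * z.1.1 0 j.
  by apply/funext => -[[]].
move=> z; apply: cvgM; first exact: cvg_cst.
apply: cvg_sumr => j; apply: cvgM; last exact: continuous_v.
apply: cvgM; last exact: continuous_q.
apply: cvgM; last exact: continuous_a.
by apply: cvgB; [exact: continuous_x | exact: cvg_cst].
Qed.

Lemma RP1_closed : closed (RP1_feasible D).
Proof.
pose flow j (z : program_point) := z.1.1 0 j - (theta D j +
  \sum_(i < J) (1 - z.2 0 i * expR (alpha D i - beta D i * z.1.2 0 i))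
                       * rho D i j * z.1.1 0 i).
pose usage r (z : program_point) := lambda_bar D *
  (\sum_(j < J) phi D r j * z.2 0 j
             * expR (alpha D j - beta D j * z.1.2 0 j) * z.1.1 0 j).
have -> : RP1_feasible D =
    \bigcap_j (flow j @^-1` [set 0]) `&`
    \bigcap_r (usage r @^-1` [set y | y <= varphi D r]) `&`
    (\bigcap_j ((fun z : program_point => z.2 0 j) @^-1` `[0, 1]) `&`
    \bigcap_j ((fun z : program_point => z.1.2 0 j) @^-1` `[x_lo D j, x_up D j])).
  apply/seteqP; split=> [[[v x] a] [fl re ha hx]|[[v x] a] [[fl re] [ha hx]]].
    split; split=> j _ /=; rewrite ?in_itv//=.
    - by rewrite /flow /= {1}fl subrr.
    - exact: re.
  split=> j.
  - by have /eqP := fl j I; rewrite subr_eq0 => /eqP.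
  - exact: re j I.
  - by have := ha j I; rewrite /= in_itv.
  - by have := hx j I; rewrite /= in_itv.
apply: closedI; apply: closedI; apply: closed_bigI => j _.
- apply: (proj1 (continuous_closedP _)); last exact: closed_eq.
  move=> z; apply: cvgB; first exact: continuous_v.
  apply: cvgD; first exact: cvg_cst.
  apply: cvg_sumr => i; apply: cvgM; last exact: continuous_v.
  apply: cvgM; last exact: cvg_cst.
  apply: cvgB; first exact: cvg_cst.
  by apply: cvgM; [exact: continuous_a | exact: continuous_q].
- apply: (proj1 (continuous_closedP _)); last exact: closed_le.
  move=> z; apply: cvgM; first exact: cvg_cst.
  apply: cvg_sumr => i; apply: cvgM; last exact: continuous_v.
  apply: cvgM; last exact: continuous_q.
  by apply: cvgM; [exact: cvg_cst | exact: continuous_a].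
- by apply: (proj1 (continuous_closedP _)) => //; exact: interval_closed.
- by apply: (proj1 (continuous_closedP _)) => //; exact: interval_closed.
Qed.

(** A closed subset of a product of boxes: those for [x] and [a] are constraints of (RP1), the one
    for [v] comes from the comparison principle. *)
Lemma RP1_compact : compact (RP1_feasible D).
Proof.
have [w hw] := RP1_v_bounded.
apply: (subclosed_compact RP1_closed (B :=
  [set v : 'rV[R]_J | forall j, `[0, w j]%classic (v 0 j)] `*`
  [set x : 'rV[R]_J | forall j, `[x_lo D j, x_up D j]%classic (x 0 j)] `*`
  [set a : 'rV[R]_J | forall j, `[0, 1]%classic (a 0 j)])).
  have box (l u : 'I_J -> R) :
      compact [set y : 'rV[R]_J | forall j, `[l j, u j]%classic (y 0 j)].
    by apply: (rV_compact (A := fun j => `[l j, u j]%classic)) => j;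
      exact: segment_compact.
  by apply: compact_setX; [apply: compact_setX|]; exact: box.
move=> [[v x] a] f; have [_ _ ha hx] := f.
split; first split; move=> j /=; rewrite in_itv//=.
by rewrite (RP1_v_ge0 j f) (hw _ _ _ j f).
Qed.

End programs.

(** * Existence and recovery of optimal solutions *)

(** The existence of an (RP2) optimum is included so that the recovery claim is not vacuous when
    (RP1) is feasible. *)
Theorem theorem5p5 (R : realType) (J m : nat) (D : pricing_data R J m)
    (hD : standing_assumptions D) :
  convex_set (RP2_feasible D) /\
  (RP1_feasible D !=set0 ->
    [/\ exists z, RP1_optimal D z,
        exists z, RP2_optimal D z
      & forall v d u : 'rV[R]_J, RP2_optimal D (v, d, u) ->
          RP1_optimal D (v, recovered_x D d u, recovered_a D v d u)]).
Proof.
split=> [|ne]; first exact: RP2_convex.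
have [z /set_mem fz maxz] := compact_EVT_max ne (RP1_compact hD)
  (continuous_subspaceT (@RP1_objective_continuous _ _ _ D)).
have optz : RP1_optimal D z by split=> // y fy; apply: maxz; exact: mem_set.
split; first by exists z.
- case: z {fz maxz} optz => [[v x] a] [fz maxz].
  have [f2 o2] := RP1_to_RP2 hD fz.
  (* The image of an (RP1) optimum is optimal, since every (RP2) competitor maps back to an (RP1)
     point of equal objective. *)
  eexists; split; first exact: f2.
  move=> [[v' d'] u'] fy; have [f1 o1] := RP2_to_RP1 hD fy.
  by rewrite o2 -o1; exact: maxz.
- move=> v d u [f2 max2]; have [f1 o1] := RP2_to_RP1 hD f2; split=> //.
  move=> [[v' x'] a'] fy; have [f2' o2'] := RP1_to_RP2 hD fy.
  by rewrite o1 -o2'; exact: max2.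
Qed.
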